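(* There exists a sequence of functions $(f_n)_{n\ge 1}$ in $W_2^1(\mathbb{R})$ whose Fourier transforms differ only by their phases, i.e. $|\tilde f_n(k)|=|\tilde f_m(k)|$ for almost every $k\in\mathbb{R}$ and all $n,m\ge 1$, such that the norm $\|f_n\|_{W_2^1(\mathbb{R})}$ is the same for all $n$, and such that the sequence undergoes a gradient catastrophe: $\sup_{n\ge 1}\|f_n\|_{L_\infty(\mathbb{R})}<\infty$, while $\|f_n'\|_{L_\infty(\mathbb{R})}<\infty$ for each $n$ and $\|f_n'\|_{L_\infty(\mathbb{R})}\to\infty$ as $n\to\infty$.
   Context: $W_2^1(\mathbb{R})$ is the Sobolev space of (complex-valued) functions $f\in L_2(\mathbb{R})$ with weak derivative $f'\in L_2(\mathbb{R})$, with norm $\|f\|_{W_2^1}^2=\|f\|_{L_2}^2+\|f'\|_{L_2}^2$. The Fourier transform of $f$ is denoted $\tilde f$ and written $\tilde f=|\tilde f|\exp(i\phi)$, where $\phi$ is called its phase. A gradient catastrophe means an unbounded increase of the derivative of a function while the function itself remains bounded; here it is understood along a sequence of functions. *)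

(* Defs.v *)
(* MathComp-Analysis, over an arbitrary [R : realType]. *)
From HB Require Import structures.
From mathcomp Require Import all_boot all_order all_algebra.
From mathcomp Require Import complex.
From mathcomp Require Import all_classical all_reals all_analysis.
Set Implicit Arguments.
Unset Strict Implicit.
Unset Printing Implicit Defensive.
Import Order.TTheory GRing.Theory Num.Theory.
Import numFieldNormedType.Exports.
Local Open Scope classical_set_scope.
Local Open Scope ring_scope.
Local Open Scope complex_scope.

(* The [R]-valued modulus; the generic norm on [R[i]] takes values in [R[i]]. *)
Definition cmod (R : realType) (z : R[i]) : R := ComplexField.Normc.normc z.

Definition cLnorm (R : realType) (p : \bar R) (f : R -> R[i]) : \bar R :=
  'N[@lebesgue_measure R]_p[(fun x : R => (cmod (f x))%:E)]%E.

Definition cmeasurable (R : realType) (f : R -> R[i]) : Prop :=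
  measurable_fun [set: R] (fun x => complex.Re (f x)) /\
  measurable_fun [set: R] (fun x => complex.Im (f x)).

Definition L2 (R : realType) (f : R -> R[i]) : Prop :=
  cmeasurable f /\ (cLnorm 2%:E f < +oo)%E.

(* Componentwise integral; it is the usual one as soon as both components are
   integrable, which is the case at each use below. *)
Definition cintegral (R : realType) (D : set R) (f : R -> R[i]) : R[i] :=
  Rintegral (@lebesgue_measure R) D (fun x => complex.Re (f x)) +i*
  Rintegral (@lebesgue_measure R) D (fun x => complex.Im (f x)).

Definition test_function (R : realType) (phi : R -> R) : Prop :=
  (forall (n : nat) (x : R), derivable (derive1n n phi) x 1) /\
  compact (closure [set x : R | phi x != 0]).

(* Meant for [f] and [g] locally integrable.  Testing against complex-valued
   functions gives the same notion, by linearity. *)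
Definition is_weak_derivative (R : realType) (f g : R -> R[i]) : Prop :=
  forall phi : R -> R, test_function phi ->
    cintegral [set: R] (fun x => f x * (derive1 phi x)%:C) =
    - cintegral [set: R] (fun x => g x * (phi x)%:C).

(* An element of the Sobolev space is packed with a representative of its weak
   derivative, which it determines almost everywhere. *)
Record W21 (R : realType) : Type := MkW21 {
  w21_fun :> R -> R[i];
  w21_deriv : R -> R[i];
  w21_fun_L2 : L2 w21_fun;
  w21_deriv_L2 : L2 w21_deriv;
  w21_weak : is_weak_derivative w21_fun w21_deriv }.

Definition w21_norm (R : realType) (f : W21 R) : R :=
  Num.sqrt (fine (cLnorm 2%:E f) ^+ 2 +
            fine (cLnorm 2%:E (w21_deriv f)) ^+ 2).

Definition expi (R : realType) (t : R) : R[i] := cos t +i* sin t.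

Definition truncated_fourier (R : realType) (f : R -> R[i]) (A k : R) : R[i] :=
  cintegral `[- A, A] (fun x => f x * expi (- (k * x))).

(* The Fourier-Plancherel transform, with kernel [exp (- i k x)] and without
   normalising constant: [g] is the limit in L2, as [A] tends to infinity, of the
   Fourier integrals of [f] over [[- A, A]].  An element of W21 need not be
   integrable, so the Fourier integral over the whole line may fail to exist. *)
Definition is_fourier_transform (R : realType) (f g : R -> R[i]) : Prop :=
  L2 g /\
  cLnorm 2%:E (fun k => g k - truncated_fourier f A k) @[A --> +oo%R] -->
    0%E.

(* Main.v *)
Require Import Defs.
From HB Require Import structures.
From mathcomp Require Import all_boot all_order all_algebra.
From mathcomp Require Import complex.
From mathcomp Require Import all_classical all_reals all_analysis.
From mathcomp Require Import measurable_realfun ess_sup_inf ring lra.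
Import Order.TTheory GRing.Theory Num.Theory.
Import numFieldNormedType.Exports.
Local Open Scope classical_set_scope.
Local Open Scope ring_scope.

(** The functions are obtained from [exp (- |x|)] by iterating an all-pass
    filter that sharpens the corner at the origin.

    Let [f] be real and let [u] solve [u' = a (f - u)], so that
    [f = u + u' / a].  Put [h = 2 u - f = u - u' / a].  On the Fourier side the
    transforms of [f] and [h] are [1 + i k / a] and [1 - i k / a] times that of
    [u], hence have the same modulus.  The norms agree as well: the squares of
    [f] and [h] differ by the derivative of [(2 / a) u ^ 2], which integrates to
    zero, and the same identity applies to [f'], [h'] and [u'].  Reflecting
    [x] to [- x] conjugates the transform of a real function and again
    preserves everything.

    What changes is the corner at [0].  As [u'] is continuous and, for large
    [a], [u' (0)] is close to the left slope [f' (0-)], the function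
    [h' = 2 u' - f'] keeps the left slope up to a small error, while the right
    slope [r] is replaced by about [2 l - r], where [l] is the left slope: the
    jump [r - l] of the derivative changes sign but not size.  The reflection of
    the line turns the new slopes [l] and [2 l - r] into [r - 2 l] on the left
    and [- l] on the right, so that the next filter increases the absolute value
    of the slopes again.  Starting from the slopes [1] and [- 1] of [exp (- |x|)], the
    left slope after [n] steps is at least [n + 1] in absolute value as soon as
    the cut-off frequencies are so large that each error is at most [1]
    ([slopes_step], [focusing_slopes]).  The functions themselves remain bounded
    because the Sobolev norm, which is constant, controls the supremum
    ([two_sided_sqr_le]).

    All these functions are finite sums of exponentials on each half line, and
    this class is stable under the filter provided [a] is larger than the
    previous exponents.  A sum [c_1 exp (- a_1 x) + ... + c_r exp (- a_r x)] is
    encoded by the list of pairs [(c_i, a_i)].  Its value, its derivative, its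
    Fourier integral are all of the form [c_1 phi (a_1) + ... + c_r phi (a_r)]
    for a suitable [phi], and its energy is a double sum of the same kind, so
    that the properties of the filter are identities between rational functions
    of the exponents ([energy_allpass], [fourier_allpass]).  Analysis is only
    needed to identify these sums with integrals, for which explicit primitives
    are available. *)

(** * Exponential sums and the all-pass filter *)

Section ExponentialSums.
Context {R : realType}.
Implicit Types (p q u : seq (R * R)) (phi psi : R -> R) (a k x : R).

(** For [phi a] equal to [exp (- a x)], [1], [a], ... this gives the value at
    [x], the value at [0], minus the slope at [0], ... of the exponential sum
    encoded by [p]; an identity valid for all [phi] is an equality of
    exponential sums. *)
Definition spectral_sum phi p : R := \sum_(t <- p) t.1 * phi t.2.
Definition reweight psi p := [seq (t.1 * psi t.2, t.2) | t <- p].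
Definition expsum p x : R := spectral_sum (fun a => expR (- a * x)) p.

(** The integral of the square of [expsum p] over the positive half line; see
    [energyE_integral]. *)
Definition energy p : R := \sum_(s <- p) \sum_(t <- p) s.1 * t.1 / (s.2 + t.2).

(** The common lower bound [1] gives all these sums the same decay rate; the
    filter only adds exponents that satisfy it. *)
Definition decaying p := forall t, t \in p -> 1 <= t.2.

Lemma spectral_sum_cat phi p q :
  spectral_sum phi (p ++ q) = spectral_sum phi p + spectral_sum phi q.
Proof. by rewrite /spectral_sum big_cat. Qed.

Lemma spectral_sum1 phi (t : R * R) : spectral_sum phi [:: t] = t.1 * phi t.2.
Proof. by rewrite /spectral_sum big_seq1. Qed.

Lemma spectral_sum_reweight phi psi p :
  spectral_sum phi (reweight psi p) = spectral_sum (fun a => psi a * phi a) p.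
Proof.
by rewrite /spectral_sum big_map; apply: eq_bigr => t _ /=; rewrite mulrA.
Qed.

Lemma eq_spectral_sum phi psi p :
  (forall t, t \in p -> phi t.2 = psi t.2) ->
  spectral_sum phi p = spectral_sum psi p.
Proof.
by move=> h; rewrite /spectral_sum; apply: eq_big_seq => t tp /=; rewrite h.
Qed.

Lemma spectral_sumD phi psi p :
  spectral_sum (fun a => phi a + psi a) p = spectral_sum phi p + spectral_sum psi p.
Proof.
by rewrite /spectral_sum -big_split; apply: eq_bigr => t _; rewrite mulrDr.
Qed.

Lemma spectral_sumZ c phi p :
  spectral_sum (fun a => c * phi a) p = c * spectral_sum phi p.
Proof.
by rewrite /spectral_sum mulr_sumr; apply: eq_bigr => t _; rewrite mulrCA.
Qed.

Lemma le_spectral_sum phi psi p :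
  (forall t, t \in p -> `|phi t.2| <= psi t.2) ->
  `|spectral_sum phi p| <= \sum_(t <- p) `|t.1| * psi t.2.
Proof.
move=> h; rewrite /spectral_sum; apply: le_trans (ler_norm_sum _ _ _) _.
rewrite big_seq [leRHS]big_seq; apply: ler_sum => t tp.
by rewrite normrM ler_wpM2l// h.
Qed.

Lemma spectral_sum_affine c p :
  spectral_sum (cst 1) (reweight (fun b => 1 + b * c) p) =
  spectral_sum (cst 1) p + c * spectral_sum id p.
Proof.
rewrite spectral_sum_reweight -spectral_sumZ -spectral_sumD.
by apply: eq_spectral_sum => t _ /=; ring.
Qed.

Lemma decaying_reweight psi p : decaying p -> decaying (reweight psi p).
Proof. by move=> h t /mapP[s sp ->] /=; exact: h. Qed.

Lemma energy_reweight psi p : energy (reweight psi p) =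
  \sum_(s <- p) \sum_(t <- p) s.1 * t.1 * (psi s.2 * psi t.2 / (s.2 + t.2)).
Proof.
rewrite /energy big_map; apply: eq_bigr => s _; rewrite big_map.
by apply: eq_bigr => t _ /=; ring.
Qed.

(** With [u] the sum encoded by [p], the left-hand side is the energy of
    [u - a u']; the last term comes from the cross term, as the integral of
    [- 2 u u'] is [u (0) ^ 2]. *)
Lemma energy_reweight_affine a p : decaying p ->
  energy (reweight (fun b => 1 + b * a) p) =
  energy p + a ^+ 2 * energy (reweight id p) + a * spectral_sum (cst 1) p ^+ 2.
Proof.
move=> dp; rewrite !energy_reweight /energy /spectral_sum.
rewrite (expr2 (\sum_(t <- p) _)) mulr_suml !mulr_sumr -!big_split /=.
apply: eq_big_seq => s sp; rewrite !mulr_sumr -!big_split /=.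
apply: eq_big_seq => t tp.
have := dp _ sp; have := dp _ tp => ht hs.
by field; lra.
Qed.

(** The solution of [u' = a (f - u)] that is bounded on the whole line, for [f]
    equal to the sum [p] on the right and to the reflected sum [q] on the left.
    A mode [exp (- b x)] of [p] is multiplied by [a / (a - b)] and a mode
    [exp (b x)] of [q] by [a / (a + b)]; the additional mode [exp (- a x)] on
    the right restores continuity at the origin. *)
Definition low_right a p q := rcons (reweight (fun b => a / (a - b)) p)
  (spectral_sum (fun b => a / (a + b)) q - spectral_sum (fun b => a / (a - b)) p, a).
Definition low_left a q := reweight (fun b => a / (a + b)) q.

(** On the left half line the sum is a function of [- x], so that the sign of the
    derivative in [u - u' / a] is opposite to that on the right. *)
Definition allpass_right a p q := reweight (fun b => 1 + b * a^-1) (low_right a p q).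
Definition allpass_left a q := reweight (fun b => 1 + b * - a^-1) (low_left a q).

(** This is the equation [u + u' / a = f] on the right half line; the mode
    [exp (- a x)] is annihilated. *)
Lemma spectral_sum_low_right a p q phi : 1 <= a ->
  (forall t, t \in p -> t.2 < a) ->
  spectral_sum phi (reweight (fun b => 1 + b * - a^-1) (low_right a p q)) =
  spectral_sum phi p.
Proof.
move=> a1 pa; rewrite /low_right -cats1 spectral_sum_reweight spectral_sum_cat.
rewrite spectral_sum1 spectral_sum_reweight /= mulrN divff ?subrr; last lra.
rewrite mul0r mulr0 addr0; apply: eq_spectral_sum => t /pa ta.
by field; rewrite subr_eq0; apply/andP; split; lra.
Qed.

Lemma spectral_sum_low_left a q phi : 1 <= a -> decaying q ->
  spectral_sum phi (reweight (fun b => 1 + b * a^-1) (low_left a q)) =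
  spectral_sum phi q.
Proof.
move=> a1 dq; rewrite /low_left !spectral_sum_reweight.
by apply: eq_spectral_sum => t /dq ta; field; apply/andP; split; lra.
Qed.

Lemma low_pass_continuous a p q :
  spectral_sum (cst 1) (low_right a p q) = spectral_sum (cst 1) (low_left a q).
Proof.
rewrite /low_right -cats1 spectral_sum_cat spectral_sum1 !spectral_sum_reweight.
have e psi u : spectral_sum (fun b => psi b * cst 1 b) u = spectral_sum psi u.
  by apply: eq_spectral_sum => t _; rewrite mulr1.
by rewrite !e mulr1 addrC subrK.
Qed.

Lemma energyE p :
  energy p = spectral_sum (fun a => spectral_sum (fun b => (a + b)^-1) p) p.
Proof.
rewrite /energy /spectral_sum; apply: eq_bigr => s _; rewrite mulr_sumr.
by apply: eq_bigr => t _; rewrite mulrA.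
Qed.

Lemma energy_ext p q :
  (forall phi, spectral_sum phi p = spectral_sum phi q) -> energy p = energy q.
Proof.
by move=> h; rewrite !energyE h; apply: eq_spectral_sum => t _; rewrite h.
Qed.

Lemma decaying_low_right a p q : 1 <= a -> decaying p -> decaying (low_right a p q).
Proof.
move=> a1 dp t; rewrite /low_right mem_rcons inE => /predU1P[->//|].
exact: decaying_reweight.
Qed.

Lemma decaying_low_left a q : decaying q -> decaying (low_left a q).
Proof. exact: decaying_reweight. Qed.

(** By [energy_reweight_affine] the energies of [u + u' / a] and [u - u' / a] differ
    by a multiple of [u (0) ^ 2] on each side, with opposite signs. *)
Lemma energy_allpass a p q : 1 <= a -> decaying p -> decaying q ->
  (forall t, t \in p -> t.2 < a) ->
  energy (allpass_right a p q) + energy (allpass_left a q) = energy p + energy q.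
Proof.
move=> a1 dp dq pa.
rewrite -(energy_ext _ _ (fun phi => spectral_sum_low_right a p q phi a1 pa)).
rewrite -[energy q](energy_ext _ _ (fun phi => spectral_sum_low_left a q phi a1 dq)).
rewrite /allpass_right /allpass_left !energy_reweight_affine;
  try by [exact: decaying_low_right|exact: decaying_low_left].
by rewrite low_pass_continuous; ring.
Qed.

Lemma reweightC phi psi p :
  reweight phi (reweight psi p) = reweight psi (reweight phi p).
Proof.
by rewrite /reweight -!map_comp; apply: eq_map => t /=; rewrite mulrAC.
Qed.

(** Since [u' = a (f - u)] and both [f] and [u] are continuous at the origin, so
    is [u']. *)
Lemma low_pass_slope a p q : 1 <= a -> decaying q ->
  (forall t, t \in p -> t.2 < a) ->
  spectral_sum (cst 1) p = spectral_sum (cst 1) q ->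
  spectral_sum id (low_right a p q) = - spectral_sum id (low_left a q).
Proof.
move=> a1 dq pa; rewrite -(spectral_sum_low_right a p q _ a1 pa).
rewrite -(spectral_sum_low_left a q _ a1 dq) !spectral_sum_affine.
rewrite low_pass_continuous => /addrI; rewrite mulNr -mulrN => /esym/mulfI ->.
  by rewrite opprK.
by rewrite invr_neq0// gt_eqF//; lra.
Qed.

(** The derivatives satisfy the same equation [f' = u' + u'' / a], and [u'] is
    continuous by [low_pass_slope], so the argument of [energy_allpass] applies. *)
Lemma energy_allpass_derivative a p q : 1 <= a -> decaying p -> decaying q ->
  (forall t, t \in p -> t.2 < a) ->
  spectral_sum (cst 1) p = spectral_sum (cst 1) q ->
  energy (reweight id (allpass_right a p q)) +
    energy (reweight id (allpass_left a q)) =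
  energy (reweight id p) + energy (reweight id q).
Proof.
move=> a1 dp dq pa pq.
have ext (u v : seq (R * R)) : (forall phi, spectral_sum phi u = spectral_sum phi v) ->
    energy (reweight id u) = energy (reweight id v).
  by move=> h; apply: energy_ext => phi; rewrite !spectral_sum_reweight h.
rewrite -(ext _ _ (fun phi => spectral_sum_low_right a p q phi a1 pa)).
rewrite -[energy (reweight id q)](ext _ _ (fun phi => spectral_sum_low_left a q phi a1 dq)).
rewrite /allpass_right /allpass_left !(reweightC id (fun b => 1 + b * _)) !energy_reweight_affine;
  try by apply: decaying_reweight; first [exact: decaying_low_right|exact: decaying_low_left].
have e u : spectral_sum (cst 1) (reweight id u) = spectral_sum id u.
  by rewrite spectral_sum_reweight; apply: eq_spectral_sum => t _ /=; rewrite mulr1.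
by rewrite !e low_pass_slope// sqrrN; ring.
Qed.

(** The hypothesis is about the energy of [u + u'], whose cross term is
    [- u (0) ^ 2]. *)
Lemma energy_cauchy p : decaying p -> 0 <= energy (reweight (fun b => 1 + b * -1) p) ->
  spectral_sum (cst 1) p ^+ 2 <= energy p + energy (reweight id p).
Proof. by move=> dp; rewrite energy_reweight_affine//; lra. Qed.

(** The integrals of [exp (- a x) cos (k x)] and [exp (- a x) sin (k x)] over the
    positive half line. *)
Definition cos_weight k a : R := a / (a ^+ 2 + k ^+ 2).
Definition sin_weight k a : R := k / (a ^+ 2 + k ^+ 2).
Definition fourier_re p q k :=
  spectral_sum (cos_weight k) p + spectral_sum (cos_weight k) q.
Definition fourier_im p q k :=
  spectral_sum (sin_weight k) q - spectral_sum (sin_weight k) p.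

(** Writing [X + i Y] for the transform of [u], those of [u + u' / a] and
    [u - u' / a] are [(1 + i k / a) (X + i Y)] and [(1 - i k / a) (X + i Y)]: the
    boundary terms of the integrations by parts cancel because [u] is
    continuous at the origin. *)
Lemma fourier_allpass a p q k : 1 <= a -> decaying p -> decaying q ->
  (forall t, t \in p -> t.2 < a) ->
  fourier_re (allpass_right a p q) (allpass_left a q) k ^+ 2 +
    fourier_im (allpass_right a p q) (allpass_left a q) k ^+ 2 =
  fourier_re p q k ^+ 2 + fourier_im p q k ^+ 2.
Proof.
move=> a1 dp dq pa; rewrite /fourier_re /fourier_im.
rewrite -!(spectral_sum_low_right a p q _ a1 pa).
rewrite -!(spectral_sum_low_left a q _ a1 dq) /allpass_right /allpass_left.
have dr := decaying_low_right a p q a1 dp.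
have dl := decaying_low_left a q dq.
have ec c u : decaying u ->
    spectral_sum (cos_weight k) (reweight (fun b => 1 + b * c) u) =
    spectral_sum (cos_weight k) u +
    c * (spectral_sum (cst 1) u - k * spectral_sum (sin_weight k) u).
  move=> du; rewrite spectral_sum_reweight mulrBr -mulrN -mulrN mulrA mulrN -mulNr.
  rewrite -mulNr -!spectral_sumZ -!spectral_sumD; apply: eq_spectral_sum => t /du tu.
  rewrite /cos_weight /sin_weight /=; field.
  by rewrite gt_eqF// ltr_pwDl ?sqr_ge0// exprn_gt0//; lra.
have es c u : spectral_sum (sin_weight k) (reweight (fun b => 1 + b * c) u) =
    spectral_sum (sin_weight k) u + c * k * spectral_sum (cos_weight k) u.
  rewrite spectral_sum_reweight -spectral_sumZ -spectral_sumD.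
  by apply: eq_spectral_sum => t _; rewrite /cos_weight /sin_weight /=; ring.
by rewrite !ec// !es low_pass_continuous; ring.
Qed.

Lemma allpass_continuous a p q : 1 <= a -> decaying q ->
  (forall t, t \in p -> t.2 < a) ->
  spectral_sum (cst 1) p = spectral_sum (cst 1) q ->
  spectral_sum (cst 1) (allpass_right a p q) = spectral_sum (cst 1) (allpass_left a q).
Proof.
move=> a1 dq pa pq; rewrite /allpass_right /allpass_left !spectral_sum_affine.
by rewrite low_pass_continuous low_pass_slope//; ring.
Qed.

(** Twice the difference between the left slope of [f] at the origin and
    [u' (0)]. *)
Definition slope_error a q := 2 * spectral_sum (fun b => b ^+ 2 / (a + b)) q.

Lemma allpass_left_slope a q : 1 <= a -> decaying q ->
  spectral_sum id (allpass_left a q) = spectral_sum id q - slope_error a q.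
Proof.
move=> a1 dq; rewrite /slope_error -mulNr -spectral_sumZ -spectral_sumD.
rewrite /allpass_left /low_left !spectral_sum_reweight.
by apply: eq_spectral_sum => t /dq tq /=; field; apply/andP; split; lra.
Qed.

Lemma allpass_right_slope a p q : 1 <= a -> decaying q ->
  (forall t, t \in p -> t.2 < a) ->
  spectral_sum (cst 1) p = spectral_sum (cst 1) q ->
  spectral_sum id (allpass_right a p q) =
  slope_error a q - 2 * spectral_sum id q - spectral_sum id p.
Proof.
move=> a1 dq pa pq; rewrite -(spectral_sum_low_right a p q id a1 pa).
have e : spectral_sum id (allpass_right a p q) +
    spectral_sum id (reweight (fun b => 1 + b * - a^-1) (low_right a p q)) =
    2 * spectral_sum id (low_right a p q).
  rewrite /allpass_right !(spectral_sum_reweight id) -spectral_sumZ -spectral_sumD.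
  by apply: eq_spectral_sum => t _; ring.
have el : spectral_sum id (low_left a q) +
    spectral_sum (fun b => b ^+ 2 / (a + b)) q = spectral_sum id q.
  rewrite /low_left spectral_sum_reweight -spectral_sumD.
  by apply: eq_spectral_sum => t /dq tq /=; field; lra.
apply/eqP; rewrite eq_sym subr_eq e low_pass_slope// -el /slope_error.
by apply/eqP; ring.
Qed.

(** The first sum keeps the filter away from the resonances [a = b], the second
    one makes [slope_error] at most [1]. *)
Definition cutoff p q : R :=
  1 + \sum_(t <- p) t.2 + 2 * \sum_(t <- q) `|t.1| * t.2 ^+ 2.

Lemma cutoff_gt p q t : decaying p -> t \in p -> t.2 < cutoff p q.
Proof.
move=> dp tp; rewrite /cutoff.
have h : 0 <= \sum_(t <- q) `|t.1| * t.2 ^+ 2.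
  by apply: sumr_ge0 => s _; rewrite mulr_ge0// sqr_ge0.
suff : t.2 <= \sum_(s <- p) s.2 by lra.
rewrite (big_rem t)//= lerDl big_seq; apply: sumr_ge0 => s /mem_rem/dp; lra.
Qed.

Lemma cutoff_ge1 p q : decaying p -> 1 <= cutoff p q.
Proof.
move=> dp; rewrite /cutoff -addrA lerDl addr_ge0//.
  by rewrite big_seq; apply: sumr_ge0 => s /dp; lra.
by rewrite mulr_ge0//; apply: sumr_ge0 => s _; rewrite mulr_ge0// sqr_ge0.
Qed.

Lemma cutoff_error p q : decaying p -> decaying q ->
  `|slope_error (cutoff p q) q| <= 1.
Proof.
move=> dp dq; have a1 := cutoff_ge1 p q dp.
rewrite /slope_error normrM ger0_norm//.
have h : `|spectral_sum (fun b => b ^+ 2 / (cutoff p q + b)) q| <=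
    \sum_(t <- q) `|t.1| * (t.2 ^+ 2 / cutoff p q).
  apply: (le_spectral_sum _ (fun b => b ^+ 2 / cutoff p q)) => t /dq tq.
  rewrite ger0_norm ?divr_ge0 ?sqr_ge0//; last lra.
  by rewrite ler_wpM2l ?sqr_ge0// lef_pV2 ?posrE; lra.
apply: le_trans (ler_wpM2l _ h) _ => //.
under eq_bigr do rewrite mulrA.
rewrite -mulr_suml mulrA ler_pdivrMr; last lra.
rewrite mul1r /cutoff lerDr addr_ge0// big_seq; apply: sumr_ge0 => s /dp; lra.
Qed.

End ExponentialSums.

(** * Energy of an exponential sum as an integral *)

Section Calculus.
Context {R : realType}.
Implicit Types (p q u : seq (R * R)) (phi psi : R -> R) (a k x : R).
Local Notation mu := (@lebesgue_measure R).

Lemma expsum_cons t p x : expsum (t :: p) x = t.1 * expR (- t.2 * x) + expsum p x.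
Proof. by rewrite /expsum /spectral_sum big_cons. Qed.

Lemma expsum_nil : @expsum R [::] = cst 0.
Proof. by apply: funext => y; rewrite /expsum /spectral_sum big_nil. Qed.

Lemma expsum_at0 p : expsum p 0 = spectral_sum (cst 1) p.
Proof. by apply: eq_spectral_sum => t _; rewrite mulr0 expR0. Qed.

Lemma is_derive_expsum p x : is_derive x 1 (expsum p) (expsum (reweight -%R p) x).
Proof.
elim: p => [|t p ih]; first by rewrite /reweight /= expsum_nil; exact: is_derive_cst.
have -> : expsum (t :: p) = (fun y => t.1 * expR (- t.2 * y)) \+ expsum p.
  by apply/funext => y; rewrite expsum_cons.
rewrite [reweight _ _]/= expsum_cons; apply: is_deriveD.
apply: is_derive_eq; rewrite /= /GRing.scale /=; ring.
Qed.

Lemma continuous_expsum p : continuous (expsum p).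
Proof.
move=> x; apply: differentiable_continuous; apply/derivable1_diffP.
by case: (is_derive_expsum p x).
Qed.

Lemma expsum_le p x : decaying p -> 0 <= x ->
  `|expsum p x| <= expR (- x) * \sum_(t <- p) `|t.1|.
Proof.
move=> dp x0; rewrite mulr_sumr; under [leRHS]eq_bigr do rewrite mulrC.
apply: (le_spectral_sum _ (cst (expR (- x)))) => t /dp tp.
by rewrite ger0_norm ?expR_ge0// ler_expR mulNr lerN2 -[leLHS]mul1r ler_wpM2r.
Qed.

Lemma expsum_cvg0 p : decaying p -> expsum p x @[x --> +oo] --> 0.
Proof.
move=> dp; apply/norm_cvg0P.
apply: (@squeeze_cvgr _ _ _ _ (cst 0) (fun x => expR (- x) * \sum_(t <- p) `|t.1|)).
- apply: filterS (nbhs_pinfty_ge (num_real 0)) => x x0.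
  by rewrite normr_ge0 /=; exact: expsum_le.
- exact: cvg_cst.
- rewrite -[X in _ --> X](mul0r (\sum_(t <- p) `|t.1|)).
  by apply: cvgM; [exact: cvgr_expR|exact: cvg_cst].
Qed.

(** The square of an exponential sum is again one, and so is its primitive
    vanishing at infinity. *)
Lemma energy_tail_expsum p : decaying p -> exists2 s, decaying s &
  (forall x, energy (reweight (fun a => expR (- a * x)) p) = - expsum s x) /\
  (forall x, expsum (reweight -%R s) x = expsum p x ^+ 2).
Proof.
move=> dp; exists [seq (- (r.1 * t.1 / (r.2 + t.2)), r.2 + t.2) | r <- p, t <- p].
  by move=> _ /allpairsP[[r t] [/dp rp /dp tp ->]] /=; lra.
split=> x.
  rewrite energy_reweight /expsum /spectral_sum big_allpairs_dep -sumrN.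
  apply: eq_bigr => r _; rewrite -sumrN; apply: eq_bigr => t _ /=.
  by rewrite opprD mulrDl expRD; ring.
rewrite /expsum spectral_sum_reweight /spectral_sum big_allpairs_dep expr2 mulr_suml.
apply: eq_big_seq => r rp; rewrite mulr_sumr; apply: eq_big_seq => t tp /=.
have -> : expR (- (r.2 + t.2) * x) = expR (- r.2 * x) * expR (- t.2 * x).
  by rewrite -expRD; congr expR; ring.
have := dp _ rp; have := dp _ tp => *.
by field; lra.
Qed.

Lemma integral_expsum_sqr p x : decaying p ->
  (\int[mu]_(y in `[x, +oo[) (expsum p y ^+ 2)%:E =
   (energy (reweight (fun a => expR (- a * x)) p))%:E)%E.
Proof.
move=> dp; have [s ds [Es ds2]] := energy_tail_expsum p dp.
rewrite (@ge0_continuous_FTC2y _ _ (expsum s) _ 0) ?Es ?sub0e//.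
- by move=> y _; exact: sqr_ge0.
- apply: continuous_subspaceT => y; apply: (@continuous_comp _ _ _ (expsum p) (fun z : R => z ^+ 2)).
    exact: continuous_expsum.
  exact: exprn_continuous.
- exact: expsum_cvg0.
- by move=> y _; case: (is_derive_expsum s y).
- by apply: cvg_at_right_filter; exact: continuous_expsum.
- by move=> y _; rewrite derive1E (@derive_val _ _ _ _ _ _ _ (is_derive_expsum s y)) ds2.
Qed.

Lemma energyE_integral p : decaying p ->
  ((energy p)%:E = \int[mu]_(y in `[0%R, +oo[) (expsum p y ^+ 2)%:E)%E.
Proof.
move=> dp; rewrite integral_expsum_sqr//; congr EFin; apply: energy_ext => phi.
by rewrite spectral_sum_reweight; apply: eq_spectral_sum => t _; rewrite mulr0 expR0 mul1r.
Qed.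

Lemma energy_ge0 p : decaying p -> 0 <= energy p.
Proof.
move=> dp; rewrite -lee_fin energyE_integral//; apply: integral_ge0 => y _.
by rewrite lee_fin sqr_ge0.
Qed.

Lemma measurable_expsum p (D : set R) : measurable_fun D (expsum p).
Proof. by apply: measurable_funTS; apply: continuous_measurable_fun; exact: continuous_expsum. Qed.

Lemma energy_tail_le p x : decaying p -> 0 <= x ->
  energy (reweight (fun a => expR (- a * x)) p) <= energy p.
Proof.
move=> dp x0; rewrite -lee_fin -integral_expsum_sqr// (energyE_integral p)//.
apply: ge0_subset_integral => //.
- by apply/measurable_EFinP/measurable_funX; exact: measurable_expsum.
- by move=> y _; rewrite lee_fin sqr_ge0.
- by move=> y /=; rewrite !in_itv/= !andbT; exact: le_trans.
Qed.

(** Sobolev embedding, from [energy_cauchy] applied to the translated function,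
    whose coefficients are multiplied by [exp (- a x)]. *)
Lemma expsum_sqr_le p x : decaying p -> 0 <= x ->
  expsum p x ^+ 2 <= energy p + energy (reweight id p).
Proof.
move=> dp x0; set p' := reweight (fun a => expR (- a * x)) p.
have dp' : decaying p' by exact: decaying_reweight.
have -> : expsum p x = spectral_sum (cst 1) p'.
  by rewrite spectral_sum_reweight; apply: eq_spectral_sum => t _; rewrite mulr1.
apply: le_trans (energy_cauchy p' dp' _) _.
  by apply: energy_ge0; exact: decaying_reweight.
rewrite lerD ?energy_tail_le//= reweightC energy_tail_le//.
exact: decaying_reweight.
Qed.

End Calculus.

(** * Two-sided exponential sums and their Lebesgue norms *)

Section TwoSided.
Context {R : realType}.
Implicit Types (p q u : seq (R * R)) (phi psi : R -> R) (a k x : R) (g : R -> R[i]).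
Local Notation mu := (@lebesgue_measure R).

Lemma cmod_sqr (z : R[i]) : cmod z ^+ 2 = complex.Re z ^+ 2 + complex.Im z ^+ 2.
Proof. by case: z => a b; rewrite /cmod /= sqr_sqrtr// addr_ge0// sqr_ge0. Qed.

Lemma cmod_ge0 (z : R[i]) : 0 <= cmod z.
Proof. by case: z => a b; exact: sqrtr_ge0. Qed.

Lemma cmod_real x : cmod (x%:C)%C = `|x|.
Proof. by rewrite /cmod /= expr0n addr0 sqrtr_sqr. Qed.

Lemma cLnorm2E g : (cLnorm 2%:E g =
  (\int[mu]_x (complex.Re (g x) ^+ 2 + complex.Im (g x) ^+ 2)%:E) `^ 2^-1)%E.
Proof.
rewrite /cLnorm unlock; congr (_ `^ _)%E; apply: eq_integral => x _ /=.
congr EFin; rewrite powR_mulrn// real_normK ?num_real//; exact: cmod_sqr.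
Qed.

Lemma poweR_half x : 0 <= x -> ((x%:E) `^ 2^-1 = (Num.sqrt x)%:E)%E.
Proof. by move=> x0; rewrite /= powR12_sqrt. Qed.

Definition two_sided p q x : R := if 0 <= x then expsum p x else expsum q (- x).

Lemma measurable_two_sided p q : measurable_fun [set: R] (two_sided p q).
Proof.
apply: measurable_fun_ifT.
- exact: measurable_fun_ler.
- exact: measurable_expsum.
- by apply: measurableT_comp; [exact: measurable_expsum|exact: oppr_measurable].
Qed.

Lemma integral_two_sided_sqr p q : decaying p -> decaying q ->
  (\int[mu]_x (two_sided p q x ^+ 2)%:E = (energy p + energy q)%:E)%E.
Proof.
move=> dp dq.
have m2 D : measurable_fun D (fun x => (two_sided p q x ^+ 2)%:E).
  apply: measurable_funTS; apply/measurable_EFinP/measurable_funX.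
  exact: measurable_two_sided.
rewrite -(setUv `[0, +oo[%classic) ge0_integral_setU//=; last 4 first.
- exact: measurableC.
- exact: m2.
- by move=> x _; rewrite lee_fin sqr_ge0.
- exact/disj_setPCl.
rewrite EFinD (energyE_integral p)// (energyE_integral q)//; congr (_ + _)%E.
  by apply: eq_integral => x; rewrite inE/= in_itv/= andbT /two_sided => ->.
have cq : continuous (fun y : R => expsum q (- y) ^+ 2).
  move=> y; apply: (@continuous_comp _ _ _ (expsum q \o -%R) (fun z : R => z ^+ 2)).
    by apply: continuous_comp; [exact: opp_continuous|exact: continuous_expsum].
  exact: exprn_continuous.
transitivity (\int[mu]_(x in `]-oo, 0%R]) (expsum q (- x) ^+ 2)%:E)%E.
  rewrite setCitvr -[RHS]integral_itv_bndo_bndc; last first.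
    apply: measurable_funTS; apply/measurable_EFinP; exact: continuous_measurable_fun.
  apply: eq_integral => x; rewrite inE/= in_itv/= /two_sided => x0.
  by rewrite leNgt x0.
rewrite -{1}oppr0 (@ge0_integration_by_substitutionNy _ (fun x => expsum q (- x) ^+ 2)).
- by apply: eq_integral => x _ /=; rewrite opprK.
- exact: continuous_subspaceT.
- by move=> x _; exact: sqr_ge0.
Qed.

Lemma cLnorm2_two_sided p q : decaying p -> decaying q ->
  cLnorm 2%:E (fun x => (two_sided p q x)%:C)%C = (Num.sqrt (energy p + energy q))%:E.
Proof.
move=> dp dq; rewrite cLnorm2E /=.
under eq_integral do rewrite expr0n /= addr0.
by rewrite integral_two_sided_sqr// poweR_half// addr_ge0 ?energy_ge0.
Qed.

Lemma L2_two_sided p q : decaying p -> decaying q ->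
  L2 (fun x => (two_sided p q x)%:C)%C.
Proof.
move=> dp dq; split; last by rewrite cLnorm2_two_sided// ltry.
by split; [exact: measurable_two_sided|exact: measurable_cst].
Qed.

Lemma two_sided_sqr_le p q x : decaying p -> decaying q ->
  two_sided p q x ^+ 2 <= energy p + energy q +
    (energy (reweight id p) + energy (reweight id q)).
Proof.
move=> dp dq; have ep := energy_ge0 p dp; have eq := energy_ge0 q dq.
have ep' := energy_ge0 _ (decaying_reweight id _ dp).
have eq' := energy_ge0 _ (decaying_reweight id _ dq).
rewrite /two_sided; case: ifPn => x0.
  by have := expsum_sqr_le p x dp x0; lra.
have x0' : 0 <= - x by rewrite oppr_ge0 ltW// ltNge.
by have := expsum_sqr_le q (- x) dq x0'; lra.
Qed.

Lemma two_sided_le p q x : decaying p -> decaying q ->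
  `|two_sided p q x| <= \sum_(t <- p) `|t.1| + \sum_(t <- q) `|t.1|.
Proof.
move=> dp dq.
have le u y : decaying u -> 0 <= y -> `|expsum u y| <= \sum_(t <- u) `|t.1|.
  move=> du y0; apply: le_trans (expsum_le u y du y0) _.
  rewrite ler_piMl//; last by rewrite expR_le1// oppr_le0.
  by apply: sumr_ge0.
have s u : 0 <= \sum_(t <- u) `|t.1| :> R by apply: sumr_ge0.
rewrite /two_sided; case: ifPn => x0.
  by apply: le_trans (le _ _ dp x0) _; rewrite lerDl.
by apply: le_trans (le _ _ dq _) _; rewrite ?lerDr ?oppr_ge0// ltW// ltNge.
Qed.

Lemma lebesgue_measure_setT_gt0 : (0 < mu [set: R])%E.
Proof.
rewrite -set_itvNyy lebesgue_measure_itv//= addye//; exact: lt0y.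
Qed.

Lemma cLnormy_le g (M : R) : (forall x, cmod (g x) <= M) -> (cLnorm +oo%E g <= M%:E)%E.
Proof.
move=> h; rewrite /cLnorm unlock lebesgue_measure_setT_gt0.
apply/ess_supP; apply: nearW => x /=; rewrite lee_fin ger0_norm ?cmod_ge0//.
Qed.

(** A lower bound on a nondegenerate interval suffices; the one to the left of the
    origin is where the slopes are measured. *)
Lemma cLnormy_ge g (M d : R) : 0 < d ->
  (forall x, - d < x < 0 -> M <= cmod (g x)) -> (M%:E <= cLnorm +oo%E g)%E.
Proof.
move=> d0 h; rewrite /cLnorm unlock lebesgue_measure_setT_gt0.
rewrite leNgt; apply/negP => lt.
have [N [mN N0 sN]] := ess_sup_ge mu (abse \o (fun x => (cmod (g x))%:E)).
pose I : set R := `](- d), 0[%classic.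
have : (mu I <= mu N)%E.
  apply: le_measure; [by rewrite inE; exact: measurable_itv|by rewrite inE|].
  move=> x; rewrite /I /= in_itv/= => xd.
  apply: sN => /= le; move: (le_lt_trans le lt); rewrite lte_fin ger0_norm ?cmod_ge0//.
  by rewrite ltNge h.
by rewrite N0 /I lebesgue_measure_itv/= lte_fin oppr_lt0 d0 -EFinD lee_fin sub0r opprK leNgt d0.
Qed.

End TwoSided.

(** * Integrals of functions glued at the origin, and Fourier integrals *)

Section Line.
Context {R : realType}.
Implicit Types (p q u : seq (R * R)) (phi psi : R -> R) (a k x M : R) (h H F : R -> R).
Local Notation mu := (@lebesgue_measure R).

Lemma integrable_continuous_itv h a b : continuous h ->
  mu.-integrable `[a, b] (EFin \o h).
Proof.
move=> ch; apply: continuous_compact_integrable; first exact: segment_compact.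
exact: continuous_subspaceT.
Qed.

Lemma Rintegral_primitive h H a b : a < b -> continuous h ->
  (forall x, is_derive x 1 H (h x)) -> \int[mu]_(x in `[a, b]) h x = H b - H a.
Proof.
move=> ab ch dH.
have cH : continuous H.
  by move=> x; apply: differentiable_continuous; apply/derivable1_diffP; case: (dH x).
rewrite /Rintegral (@continuous_FTC2 _ h H a b)//.
- exact: continuous_subspaceT.
- split; first by move=> x _; case: (dH x).
    by apply: cvg_at_right_filter; exact: cH.
  by apply: cvg_at_left_filter; exact: cH.
- by move=> x _; rewrite derive1E (@derive_val _ _ _ _ _ _ _ (dH x)).
Qed.

Lemma measurable_gluing h1 h2 F : continuous h1 -> continuous h2 ->
  (forall x, 0 <= x -> F x = h1 x) -> (forall x, x < 0 -> F x = h2 (- x)) ->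
  measurable_fun [set: R] F.
Proof.
move=> c1 c2 F1 F2.
have -> : F = fun x => if 0 <= x then h1 x else h2 (- x).
  by apply/funext => x; case: leP => [/F1|/F2].
apply: measurable_fun_ifT; first exact: measurable_fun_ler.
  exact: continuous_measurable_fun.
by apply: measurableT_comp; [exact: continuous_measurable_fun|exact: oppr_measurable].
Qed.

(** [F] is dominated by [|h1 x| + |h2 (- x)|], which is continuous on the
    whole interval. *)
Lemma integrable_gluing h1 h2 F M : continuous h1 -> continuous h2 ->
  (forall x, 0 <= x -> F x = h1 x) -> (forall x, x < 0 -> F x = h2 (- x)) ->
  mu.-integrable `[(- M), M] (EFin \o F).
Proof.
move=> c1 c2 F1 F2.
apply: (@le_integrable _ _ _ mu _ _ _ (EFin \o (fun x => `|h1 x| + `|h2 (- x)|))) => //.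
- by apply/measurable_EFinP; apply: measurable_funTS; exact: measurable_gluing F1 F2.
- move=> x _ /=; rewrite lee_fin [leRHS]ger0_norm ?addr_ge0//.
  by case: (leP 0 x) => [/F1|/F2] ->; rewrite ?lerDl ?lerDr.
- apply: integrable_continuous_itv => x; apply: cvgD.
    by apply: continuous_comp; [exact: c1|exact: norm_continuous].
  apply: (@continuous_comp _ _ _ (h2 \o -%R) (fun z : R => `|z|)); last exact: norm_continuous.
  by apply: continuous_comp; [exact: opp_continuous|exact: c2].
Qed.

Lemma Rintegral_gluing h1 h2 H1 H2 F M : 0 < M ->
  continuous h1 -> continuous h2 ->
  (forall x, is_derive x 1 H1 (h1 x)) -> (forall x, is_derive x 1 H2 (h2 x)) ->
  (forall x, 0 <= x -> F x = h1 x) -> (forall x, x < 0 -> F x = h2 (- x)) ->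
  \int[mu]_(x in `[(- M), M]) F x = H1 M - H1 0 + (H2 M - H2 0).
Proof.
move=> M0 c1 c2 d1 d2 F1 F2.
have iF := integrable_gluing _ _ _ M c1 c2 F1 F2.
have M0' := ltW M0.
have := @Rintegral_itvB _ F _ _ 0 iF; rewrite !bnd_simp oppr_le0 => /(_ M0' M0').
move/eqP; rewrite subr_eq => /eqP ->; congr (_ + _).
  rewrite -(Rintegral_primitive _ _ _ _ M0 c1 d1) Rintegral_itv_obnd_cbnd.
    by apply: eq_Rintegral => x; rewrite inE/= in_itv/= => /andP[/F1 ->].
  apply: integrableS iF => //; apply: subset_itvr.
  by rewrite bnd_simp oppr_le0.
rewrite -Rintegral_itv_bndo_bndc; last first.
  apply: integrableS iF => //; apply: subset_itvl.
  by rewrite bnd_simp.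
transitivity (\int[mu]_(x in `[(- M), 0]) (h2 \o -%R) x).
  rewrite -Rintegral_itv_bndo_bndc.
    by apply: eq_Rintegral => x; rewrite inE/= in_itv/= => /andP[_ /F2 ->].
  apply: (@integrableS _ _ _ mu `[(- M), 0]) => //.
    by apply: subset_itvl; rewrite bnd_simp.
  apply: integrable_continuous_itv => x.
  by apply: continuous_comp; [exact: opp_continuous|exact: c2].
have dL x : is_derive x 1 (fun y => - H2 (- y)) ((h2 \o -%R) x).
  have d := d2 (- x).
  have e : is_derive x 1 (H2 \o -%R) (h2 (- x) * -1) by exact: is_derive1_comp.
  by apply: is_derive_eq; rewrite mulrN1 opprK.
rewrite (Rintegral_primitive (h2 \o -%R) _ _ _ _ _ dL).
- by rewrite oppr0 !opprK addrC.
- by rewrite oppr_lt0.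
- by move=> x; apply: continuous_comp; [exact: opp_continuous|exact: c2].
Qed.

(** The integrals of [expsum p x * cos (k x)] and [expsum p x * sin (k x)] from [A]
    to infinity. *)
Definition cos_tail p k A : R :=
  cos (k * A) * expsum (reweight (cos_weight k) p) A -
  sin (k * A) * expsum (reweight (sin_weight k) p) A.
Definition sin_tail p k A : R :=
  cos (k * A) * expsum (reweight (sin_weight k) p) A +
  sin (k * A) * expsum (reweight (cos_weight k) p) A.

Lemma is_derive_trig_scale k x :
  is_derive x 1 (fun y => cos (k * y)) (- sin (k * x) * k) /\
  is_derive x 1 (fun y => sin (k * y)) (cos (k * x) * k).
Proof.
have e : is_derive x 1 (fun y => k * y) k.
  by apply: is_derive_eq; rewrite /GRing.scale /= mulr1.
by split; [exact: (@is_derive1_comp _ (@cos R))|exact: (@is_derive1_comp _ (@sin R))].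
Qed.

Lemma is_derive_trig_expsum p k x : decaying p ->
  is_derive x 1 (expsum (reweight (sin_weight k) p))
    (- k * expsum (reweight (cos_weight k) p) x) /\
  is_derive x 1 (expsum (reweight (cos_weight k) p))
    (k * expsum (reweight (sin_weight k) p) x - expsum p x).
Proof.
move=> dp; split.
  apply: is_derive_eq (is_derive_expsum _ x) _.
  rewrite /expsum !spectral_sum_reweight -spectral_sumZ.
  by apply: eq_spectral_sum => t _; rewrite /sin_weight /cos_weight; ring.
apply: is_derive_eq (is_derive_expsum _ x) _.
apply/eqP; rewrite eq_sym subr_eq; apply/eqP.
rewrite /expsum !spectral_sum_reweight -spectral_sumZ -spectral_sumD.
apply: eq_spectral_sum => t /dp tp; rewrite /sin_weight /cos_weight; field.
by rewrite gt_eqF// ltr_pwDl ?sqr_ge0// exprn_gt0//; lra.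
Qed.

Lemma is_derive_cos_tail p k x : decaying p ->
  is_derive x 1 (cos_tail p k) (- (expsum p x * cos (k * x))).
Proof.
move=> dp; have [ds dc] := is_derive_trig_expsum p k x dp.
have [dC dS] := is_derive_trig_scale k x.
by apply: is_derive_eq; rewrite /GRing.scale /=; ring.
Qed.

Lemma is_derive_sin_tail p k x : decaying p ->
  is_derive x 1 (sin_tail p k) (- (expsum p x * sin (k * x))).
Proof.
move=> dp; have [ds dc] := is_derive_trig_expsum p k x dp.
have [dC dS] := is_derive_trig_scale k x.
by apply: is_derive_eq; rewrite /GRing.scale /=; ring.
Qed.

(** The part of the Fourier integral of [two_sided p q] outside [[- A, A]]; at
    [A = 0] this is the full transform. *)
Definition fourier_tail p q A k : R[i] :=
  ((cos_tail p k A + cos_tail q k A) +i* (sin_tail q k A - sin_tail p k A))%C.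

Lemma continuous_expsum_trig p (tr : R -> R) k : continuous tr ->
  continuous (fun x => expsum p x * tr (k * x)).
Proof.
move=> ct x; apply: continuousM; first exact: continuous_expsum.
apply: (@continuous_comp _ _ _ ( *%R k) tr); last exact: ct.
exact: mulrl_continuous.
Qed.

Lemma truncated_fourier_two_sided p q A k : 0 < A -> decaying p -> decaying q ->
  truncated_fourier (fun x => (two_sided p q x)%:C)%C A k =
  fourier_tail p q 0 k - fourier_tail p q A k.
Proof.
move=> A0 dp dq; rewrite /truncated_fourier /cintegral /fourier_tail /expi.
have cc u : continuous (fun x => expsum u x * cos (k * x)).
  by apply: continuous_expsum_trig; exact: continuous_cos.
have cs u : continuous (fun x => expsum u x * sin (k * x)).
  by apply: continuous_expsum_trig; exact: continuous_sin.
have csN u : continuous (fun x => - (expsum u x * sin (k * x))).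
  by move=> x; apply: cvgN; exact: cs.
have dcN u x : decaying u ->
    is_derive x 1 (fun x => - cos_tail u k x) (expsum u x * cos (k * x)).
  by move=> du; have d := is_derive_cos_tail u k x du; apply: is_derive_eq; rewrite opprK.
have dsN u x : decaying u ->
    is_derive x 1 (fun x => - sin_tail u k x) (expsum u x * sin (k * x)).
  by move=> du; have d := is_derive_sin_tail u k x du; apply: is_derive_eq; rewrite opprK.
rewrite (Rintegral_gluing _ _ _ _ _ A A0 (cc p) (cc q)
  (fun x => dcN p x dp) (fun x => dcN q x dq)); last 2 first.
- by move=> x x0; rewrite /= mul0r subr0 cosN /two_sided x0.
- by move=> x x0; rewrite /= mul0r subr0 cosN /two_sided leNgt x0 /= mulrN cosN.
rewrite (Rintegral_gluing _ _ _ _ _ A A0 (csN p) (cs q)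
  (fun x => is_derive_sin_tail p k x dp) (fun x => dsN q x dq)); last 2 first.
- by move=> x x0; rewrite /= mul0r addr0 sinN /two_sided x0 mulrN.
- by move=> x x0; rewrite /= mul0r addr0 /two_sided leNgt x0 /= (mulrN k).
by apply/eqP; rewrite eq_complex /=; apply/andP; split; apply/eqP; ring.
Qed.

Lemma fourier_tail0 p q k : fourier_tail p q 0 k = (fourier_re p q k +i* fourier_im p q k)%C.
Proof.
have e phi u : expsum (reweight phi u) 0 = spectral_sum phi u.
  by rewrite expsum_at0 spectral_sum_reweight; apply: eq_spectral_sum => t _; rewrite mulr1.
by rewrite /fourier_tail /cos_tail /sin_tail mulr0 cos0 sin0 !mul0r !mul1r !subr0 !addr0 !e.
Qed.

(** Both weights are at most [1 / sqrt (a ^ 2 + k ^ 2)] in absolute value. *)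
Lemma weight_le a k : 1 <= a ->
  cos_weight k a ^+ 2 <= (oneDsqr k)^-1 /\ sin_weight k a ^+ 2 <= (oneDsqr k)^-1.
Proof.
move=> a1; have a2 : 1 <= a ^+ 2 by rewrite exprn_ege1.
have k2 := sqr_ge0 k.
have e b : (b / (a ^+ 2 + k ^+ 2)) ^+ 2 <= (oneDsqr k)^-1 <->
   b ^+ 2 * oneDsqr k <= (a ^+ 2 + k ^+ 2) ^+ 2.
  have s0 : 0 < a ^+ 2 + k ^+ 2 by lra.
  rewrite expr_div_n ler_pdivrMr ?exprn_gt0// [X in _ <= X]mulrC.
  by rewrite ler_pdivlMr// (lt_le_trans ltr01 (oneDsqr_ge1 k)).
rewrite /cos_weight /sin_weight; split; apply/e; rewrite /oneDsqr.
  have := mulr_ge0 (sqr_ge0 a) k2; nra.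
nra.
Qed.

Lemma expsum_weight_le p phi A k : decaying p -> 0 <= A ->
  (forall a, 1 <= a -> phi a ^+ 2 <= (oneDsqr k)^-1) ->
  expsum (reweight phi p) A ^+ 2 <=
  (\sum_(t <- p) `|t.1|) ^+ 2 * expR (- A) ^+ 2 * (oneDsqr k)^-1.
Proof.
move=> dp A0 h; set S := \sum_(t <- p) _.
have S0 : 0 <= S by apply: sumr_ge0.
have o0 : 0 < (oneDsqr k)^-1 by rewrite invr_gt0.
have hr : `|expsum (reweight phi p) A| <= S * expR (- A) * Num.sqrt (oneDsqr k)^-1.
  apply: le_trans (expsum_le _ A (decaying_reweight phi p dp) A0) _.
  rewrite mulrC -mulrA [_ * Num.sqrt _]mulrC mulrA ler_wpM2r ?expR_ge0//.
  rewrite big_map /S mulr_suml big_seq [leRHS]big_seq; apply: ler_sum => t /dp tp.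
  rewrite /= normrM ler_wpM2l// -sqrtr_sqr ler_sqrt//; exact: h.
rewrite -real_normK ?num_real//.
apply: (@le_trans _ _ ((S * expR (- A) * Num.sqrt (oneDsqr k)^-1) ^+ 2)).
  by rewrite ler_pXn2r// nnegrE// !mulr_ge0 ?expR_ge0 ?sqrtr_ge0.
by rewrite !exprMn sqr_sqrtr// ltW.
Qed.

(** The factor [4] covers the two half lines and the two components. *)
Definition mass p q : R := 4 * ((\sum_(t <- p) `|t.1|) ^+ 2 + (\sum_(t <- q) `|t.1|) ^+ 2).

(** Passing from the weighted sums to [cos_tail] and [sin_tail] is a rotation by
    the angle [k A], which disappears in the modulus. *)
Lemma fourier_tail_le p q A k : 0 <= A -> decaying p -> decaying q ->
  complex.Re (fourier_tail p q A k) ^+ 2 + complex.Im (fourier_tail p q A k) ^+ 2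
  <= mass p q * expR (- A) ^+ 2 * (oneDsqr k)^-1.
Proof.
move=> A0 dp dq; rewrite /= /mass.
have wc a : 1 <= a -> cos_weight k a ^+ 2 <= (oneDsqr k)^-1.
  by move=> a1; have [] := weight_le a k a1.
have ws a : 1 <= a -> sin_weight k a ^+ 2 <= (oneDsqr k)^-1.
  by move=> a1; have [] := weight_le a k a1.
have pc := expsum_weight_le _ _ A k dp A0 wc.
have ps := expsum_weight_le _ _ A k dp A0 ws.
have qc := expsum_weight_le _ _ A k dq A0 wc.
have qs := expsum_weight_le _ _ A k dq A0 ws.
have rot u : cos_tail u k A ^+ 2 + sin_tail u k A ^+ 2 =
    expsum (reweight (cos_weight k) u) A ^+ 2 + expsum (reweight (sin_weight k) u) A ^+ 2.
  rewrite -[RHS]mul1r -(cos2Dsin2 (k * A)) /cos_tail /sin_tail; ring.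
have := rot p; have := rot q.
have := sqr_ge0 (cos_tail p k A - cos_tail q k A).
have := sqr_ge0 (sin_tail p k A + sin_tail q k A).
move: pc ps qc qs; set o := _^-1; set E := expR _ ^+ 2.
set Sp := (\sum_(t <- p) _) ^+ 2; set Sq := (\sum_(t <- q) _) ^+ 2.
move: (cos_tail p k A) (cos_tail q k A) (sin_tail p k A) (sin_tail q k A) => cp cq sp sq.
move: (_ ^+ 2) (_ ^+ 2) (_ ^+ 2) (_ ^+ 2) => x1 x2 x3 x4.
lra.
Qed.

Lemma continuous_weighted_sum (w : R -> R -> R) (c : R -> R) p : decaying p ->
  (forall a, 1 <= a -> continuous (w^~ a)) ->
  continuous (fun k => spectral_sum (fun a => w k a * c a) p).
Proof.
move=> dp cw; elim: p dp => [|t p ih] dp.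
  rewrite (_ : (fun k => _) = cst 0); first by move=> x; exact: cvg_cst.
  by apply/funext => k; rewrite /spectral_sum big_nil.
rewrite (_ : (fun k => _) = (fun k => t.1 * (w k t.2 * c t.2)) \+
  (fun k => spectral_sum (fun a => w k a * c a) p)); last first.
  by apply/funext => k; rewrite /spectral_sum big_cons.
move=> k; apply: cvgD; last by apply: ih => s sp; apply: dp; rewrite inE sp orbT.
apply: cvgM; first exact: cvg_cst.
by apply: cvgM; [apply: cw; apply: dp; rewrite inE eqxx|exact: cvg_cst].
Qed.

Lemma continuous_weights a : 1 <= a ->
  continuous (cos_weight^~ a) /\ continuous (sin_weight^~ a).
Proof.
move=> a1.
have c : continuous (fun k : R => (a ^+ 2 + k ^+ 2)^-1).
  move=> k; apply: cvgV.
    by rewrite gt_eqF// ltr_pwDl ?sqr_ge0// exprn_gt0//; lra.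
  by apply: cvgD; [exact: cvg_cst|exact: exprn_continuous].
split=> k; apply: cvgM; [exact: cvg_cst|exact: c|exact: cvg_id|exact: c].
Qed.

Lemma continuous_fourier_tail p q A : decaying p -> decaying q ->
  continuous (fun k => complex.Re (fourier_tail p q A k)) /\
  continuous (fun k => complex.Im (fourier_tail p q A k)).
Proof.
move=> dp dq.
have e phi u : expsum (reweight phi u) A = spectral_sum (fun a => phi a * expR (- a * A)) u.
  by rewrite /expsum spectral_sum_reweight.
have cc u : decaying u -> continuous (fun k => expsum (reweight (cos_weight k) u) A).
  move=> du; under eq_fun do rewrite e.
  by apply: continuous_weighted_sum => // a /continuous_weights[].
have cs u : decaying u -> continuous (fun k => expsum (reweight (sin_weight k) u) A).
  move=> du; under eq_fun do rewrite e.
  by apply: continuous_weighted_sum => // a /continuous_weights[].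
have tc : continuous (fun k : R => cos (k * A)).
  move=> k; apply: (@continuous_comp _ _ _ (fun z : R => z * A) (@cos R)); last exact: continuous_cos.
  exact: mulrr_continuous.
have ts : continuous (fun k : R => sin (k * A)).
  move=> k; apply: (@continuous_comp _ _ _ (fun z : R => z * A) (@sin R)); last exact: continuous_sin.
  exact: mulrr_continuous.
have Cc u : decaying u -> continuous (fun k => cos_tail u k A).
  move=> du k; apply: cvgB; apply: cvgM; [exact: tc|exact: cc|exact: ts|exact: cs].
have Cs u : decaying u -> continuous (fun k => sin_tail u k A).
  move=> du k; apply: cvgD; apply: cvgM; [exact: tc|exact: cs|exact: ts|exact: cc].
by split=> k; [apply: cvgD; exact: Cc|apply: cvgB; exact: Cs].
Qed.

Lemma oneDsqrV_ge0 x : 0 <= (oneDsqr x)^-1.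
Proof. by rewrite invr_ge0 (le_trans ler01)// oneDsqr_ge1. Qed.

Lemma integral_oneDsqrV : (\int[mu]_x ((oneDsqr x)^-1)%:E = (pi : R)%:E)%E.
Proof.
rewrite ge0_symfun_integralT.
- by rewrite -set_itvcy integral0y_oneDsqr -EFinM; congr EFin; field.
- by move=> x; exact: oneDsqrV_ge0.
- exact: continuous_oneDsqrV.
- by move=> x /=; rewrite /oneDsqr sqrrN.
Qed.

Lemma cLnorm2_fourier_tail p q A : 0 <= A -> decaying p -> decaying q ->
  (cLnorm 2%:E (fourier_tail p q A) <= (Num.sqrt (mass p q * pi) * expR (- A))%:E)%E.
Proof.
move=> A0 dp dq; have [cre cim] := continuous_fourier_tail p q A dp dq.
have m0 : 0 <= mass p q.
  by rewrite /mass mulr_ge0// addr_ge0// sqr_ge0.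
rewrite cLnorm2E.
have -> : Num.sqrt (mass p q * pi) * expR (- A) =
    Num.sqrt (mass p q * expR (- A) ^+ 2 * pi).
  rewrite -mulrA [_ ^+ 2 * _]mulrC mulrA [RHS]sqrtrM ?(mulr_ge0 m0 (pi_ge0 R))//.
  by rewrite sqrtr_sqr ger0_norm// expR_ge0.
have m1 : 0 <= mass p q * expR (- A) ^+ 2 by rewrite mulr_ge0 ?m0// sqr_ge0.
have m2 : 0 <= mass p q * expR (- A) ^+ 2 * pi by rewrite mulr_ge0 ?m1// pi_ge0.
rewrite -poweR_half//.
have msq (f : R -> R) : continuous f -> measurable_fun [set: R] (fun x => f x ^+ 2).
  by move=> cf; apply: measurable_funX; exact: continuous_measurable_fun.
have mo : measurable_fun [set: R] (fun x : R => (oneDsqr x)^-1).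
  by apply: continuous_measurable_fun; exact: continuous_oneDsqrV.
apply: gt0_ler_poweR.
- by rewrite invr_ge0.
- by rewrite in_itv /= leey integral_ge0// => x _; rewrite lee_fin addr_ge0// sqr_ge0.
- by rewrite in_itv /= leey lee_fin m2.
rewrite [leRHS]EFinM -integral_oneDsqrV -ge0_integralZl//; last exact/measurable_EFinP.
apply: ge0_le_integral => //.
- by move=> x _; rewrite lee_fin addr_ge0// sqr_ge0.
- by apply/measurable_EFinP; apply: measurable_funD; exact: msq.
- by apply/measurable_EFinP; apply: measurable_funM => //.
- by move=> x _; rewrite -EFinM lee_fin; exact: fourier_tail_le.
Qed.

(** The difference with the truncated transform is [fourier_tail p q A], whose
    norm is of order [exp (- A)]. *)
Lemma is_fourier_transform_two_sided p q : decaying p -> decaying q ->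
  is_fourier_transform (fun x => (two_sided p q x)%:C)%C (fourier_tail p q 0).
Proof.
move=> dp dq; split.
  have [cre cim] := continuous_fourier_tail p q 0 dp dq.
  split; first by split; exact: continuous_measurable_fun.
  by apply: le_lt_trans (cLnorm2_fourier_tail p q 0 _ dp dq) (ltry _).
apply: (@squeeze_cvge _ _ _ _ (cst 0%E) _
  (fun A => (Num.sqrt (mass p q * pi) * expR (- A))%:E)).
- apply: filterS (nbhs_pinfty_gt (num_real 0)) => A A0; rewrite Lnorm_ge0 /=.
  rewrite (_ : (fun k => _) = fourier_tail p q A); last first.
    by apply/funext => k; rewrite truncated_fourier_two_sided// opprB addrC subrK.
  exact: cLnorm2_fourier_tail (ltW A0) dp dq.
- exact: cvg_cst.
- apply: cvg_EFin; first by near=> A.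
  rewrite -[X in _ --> X](mulr0 (Num.sqrt (mass p q * pi))).
  by apply: cvgM; [exact: cvg_cst|exact: cvgr_expR].
Unshelve. all: by end_near. Qed.

End Line.

(** * Weak derivatives and Sobolev norms *)

Section Weak.
Context {R : realType}.
Implicit Types (p q u : seq (R * R)) (phi psi : R -> R) (a k x M : R) (h H F : R -> R).
Local Notation mu := (@lebesgue_measure R).

Lemma test_function_support phi : test_function phi -> exists2 M, 0 < M &
  forall x, M <= `|x| -> phi x = 0 /\ derive1 phi x = 0.
Proof.
move=> [_ cphi]; have [M0 [_ hM]] := compact_bounded cphi.
pose M := `|M0| + 1.
have z x : M < `|x| -> phi x = 0.
  move=> xM; apply/eqP; apply: contraTT xM => px; rewrite -leNgt.
  apply: hM; first by rewrite (le_lt_trans (ler_norm _))// ltrDl.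
  exact: subset_closure.
have M0' : 0 <= M by rewrite addr_ge0.
exists (M + 1); first by rewrite ltr_wpDl.
move=> x xM; have xM' : M < `|x| by rewrite (lt_le_trans _ xM)// ltrDl.
split; first exact: z.
rewrite derive1E (@near_eq_derive _ _ _ phi (cst 0) x 1) ?derive_cst//.
have : \forall y \near x, M < `|y|.
  exact: (cvgr_gt _ (@norm_continuous _ R x) _ xM').
by apply: filterS => y; exact: z.
Qed.

Lemma Rintegral_setT_itv F M : (forall x, M < `|x| -> F x = 0) ->
  \int[mu]_x F x = \int[mu]_(x in `[(- M), M]) F x.
Proof.
move=> hF; rewrite [RHS]Rintegral_mkcond; apply: eq_Rintegral => x _.
rewrite patchE; case: ifPn => //; rewrite notin_setE /= in_itv /= => /negP.
rewrite -ler_norml -ltNge; exact: hF.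
Qed.

Lemma is_derive_expsumM p phi dphi x : is_derive x 1 phi dphi ->
  is_derive x 1 (fun y => expsum p y * phi y)
    (expsum p x * dphi + expsum (reweight -%R p) x * phi x).
Proof.
move=> d; have d1 := is_derive_expsum p x.
by apply: is_derive_eq; rewrite /GRing.scale /=; ring.
Qed.

(** The primitives [expsum p * phi] and [expsum q * phi (- x)] of the two halves
    contribute opposite boundary terms at the origin, by continuity there. *)
Lemma is_weak_derivative_two_sided p q :
  spectral_sum (cst 1) p = spectral_sum (cst 1) q ->
  is_weak_derivative (fun x => (two_sided p q x)%:C)%C
    (fun x => (two_sided (reweight -%R p) (reweight id q) x)%:C)%C.
Proof.
move=> pq phi tphi; have [M M0 hM] := test_function_support phi tphi.
case: tphi => dphi _.
have d0 x : is_derive x 1 phi (derive1 phi x).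
  by rewrite derive1E; apply: DeriveDef => //; exact: (dphi 0%N).
have c0 : continuous phi.
  by move=> x; apply: differentiable_continuous; apply/derivable1_diffP; exact: (dphi 0%N).
have c1 : continuous (derive1 phi).
  by move=> x; apply: differentiable_continuous; apply/derivable1_diffP; exact: (dphi 1%N).
have cN (g : R -> R) : continuous g -> continuous (g \o -%R).
  by move=> cg x; apply: continuous_comp; [exact: opp_continuous|exact: cg].
have cM u (g : R -> R) : continuous g -> continuous (fun x => expsum u x * g x).
  by move=> cg x; apply: cvgM; [exact: continuous_expsum|exact: cg].
have dN x : is_derive x 1 (phi \o -%R) (- derive1 phi (- x)).
  have d := d0 (- x).
  have e : is_derive x 1 (phi \o -%R) (derive1 phi (- x) * -1) by exact: is_derive1_comp.
  by apply: is_derive_eq; rewrite mulrN1.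
pose dp := reweight -%R p; pose dq := reweight id q.
pose f := fun x => two_sided p q x * derive1 phi x.
pose g := fun x => two_sided dp dq x * phi x.
have two p' q' : (forall x, 0 <= x -> two_sided p' q' x = expsum p' x) /\
    (forall x, x < 0 -> two_sided p' q' x = expsum q' (- x)).
  split=> x; rewrite /two_sided; first by move=> ->.
  by rewrite leNgt => ->.
have i_f : mu.-integrable `[(- M), M] (EFin \o f).
  apply: (integrable_gluing (fun x => expsum p x * derive1 phi x)
    (fun x => expsum q x * (derive1 phi \o -%R) x)).
  - exact: cM.
  - by apply: cM; exact: cN.
  - by move=> x x0; rewrite /f (two _ _).1.
  - by move=> x x0; rewrite /f (two _ _).2//= opprK.
have i_g : mu.-integrable `[(- M), M] (EFin \o g).
  apply: (integrable_gluing (fun x => expsum dp x * phi x)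
    (fun x => expsum dq x * (phi \o -%R) x)).
  - exact: cM.
  - by apply: cM; exact: cN.
  - by move=> x x0; rewrite /g (two _ _).1.
  - by move=> x x0; rewrite /g (two _ _).2//= opprK.
have key : \int[mu]_x f x = - \int[mu]_x g x.
  rewrite (Rintegral_setT_itv f M); last first.
    by move=> x /ltW/hM[_]; rewrite /f => ->; rewrite mulr0.
  rewrite (Rintegral_setT_itv g M); last first.
    by move=> x /ltW/hM[+ _]; rewrite /g => ->; rewrite mulr0.
  apply/eqP; rewrite -addr_eq0 -RintegralD//.
  have d1 x : is_derive x 1 (fun y => expsum p y * phi y)
      (expsum p x * derive1 phi x + expsum dp x * phi x).
    exact: is_derive_expsumM.
  have d2 x : is_derive x 1 (fun y => - (expsum q y * (phi \o -%R) y))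
      (expsum q x * (derive1 phi \o -%R) x + expsum dq x * (phi \o -%R) x).
    have d := is_derive_expsumM q _ _ x (dN x).
    apply: is_derive_eq; rewrite /= /dq.
    have -> : expsum (reweight -%R q) x = - expsum (reweight id q) x.
      rewrite /expsum !spectral_sum_reweight -mulN1r -spectral_sumZ.
      by apply: eq_spectral_sum => t _; ring.
    by ring.
  rewrite (Rintegral_gluing _ _ _ _ _ M M0 _ _ d1 d2).
  - rewrite /=; have [-> _] := hM M (ler_norm M).
    have [-> _] := hM (- M) (eq_ind_r (fun y => M <= y) (ler_norm M) (normrN M)).
    by rewrite /= oppr0 !mulr0 !expsum_at0 pq; apply/eqP; ring.
  - by move=> x; apply: cvgD; apply: cM.
  - by move=> x; apply: cvgD; apply: cM; exact: cN.
  - by move=> x x0; rewrite /f /g !(two _ _).1.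
  - by move=> x x0; rewrite /f /g !(two _ _).2//= opprK.
have RT : \int[mu]_(x in [set: R]) (0 : R) = 0 by rewrite Rintegral_cst// mul0r.
rewrite /cintegral /=.
have eR (F G : R -> R) : \int[mu]_x (F x * G x - 0 * 0) = \int[mu]_x (F x * G x).
  by apply: eq_Rintegral => x _; rewrite mulr0 subr0.
have eI (F G : R -> R) : \int[mu]_x (F x * 0 + 0 * G x) = 0.
  by rewrite -[RHS]RT; apply: eq_Rintegral => x _; rewrite mulr0 mul0r addr0.
by rewrite !eR !eI key; apply/eqP; rewrite eq_complex /= oppr0 !eqxx.
Qed.

Definition profile_W21 p q (dp : decaying p) (dq : decaying q)
    (pq : spectral_sum (cst 1) p = spectral_sum (cst 1) q) : W21 R :=
  MkW21 (L2_two_sided p q dp dq)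
    (L2_two_sided _ _ (decaying_reweight -%R p dp) (decaying_reweight id q dq))
    (is_weak_derivative_two_sided p q pq).

Lemma energy_reweightN p : energy (reweight -%R p) = energy (reweight id p).
Proof.
rewrite !energy_reweight; apply: eq_bigr => s _; apply: eq_bigr => t _.
by rewrite mulrNN.
Qed.

Lemma w21_norm_profile p q dp dq pq : w21_norm (profile_W21 p q dp dq pq) =
  Num.sqrt (energy p + energy q + (energy (reweight id p) + energy (reweight id q))).
Proof.
rewrite /w21_norm /= !cLnorm2_two_sided//; try exact: decaying_reweight.
rewrite /= !sqr_sqrtr ?energy_reweightN// addr_ge0//; apply: energy_ge0 => //;
  exact: decaying_reweight.
Qed.

(** [spectral_sum id q] is the left limit of the derivative at the origin. *)
Lemma cLnormy_profile_derivative p q (M : R) :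
  M < `|spectral_sum id q| ->
  (M%:E <= cLnorm +oo%E
     (fun x => (two_sided (reweight -%R p) (reweight id q) x)%:C)%C)%E.
Proof.
move=> hM.
have e0 : expsum (reweight id q) 0 = spectral_sum id q.
  by rewrite expsum_at0 spectral_sum_reweight; apply: eq_spectral_sum => t _; rewrite mulr1.
have : \forall y \near 0, M < `|expsum (reweight id q) y|.
  have c : {for 0, continuous (fun y => `|expsum (reweight id q) y|)}.
    by apply: continuous_comp; [exact: continuous_expsum|exact: norm_continuous].
  by apply: (cvgr_gt _ c); rewrite e0.
move=> /nbhs_ballP[d /= d0 hd]; apply: (cLnormy_ge _ _ d d0) => x /andP[dx x0].
rewrite cmod_real /two_sided (leNgt 0 x) x0 /=; apply: ltW; apply: hd.
by rewrite /ball /= sub0r opprK ltr0_norm// ltrNl.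
Qed.

End Weak.

(** * The focusing sequence *)

Section Sequence.
Context {R : realType}.
Implicit Types (p q u : seq (R * R)) (a k x M : R).

Record profile := Profile {
  right_half : seq (R * R);
  left_half : seq (R * R);
  right_decaying : decaying right_half;
  left_decaying : decaying left_half;
  halves_agree : spectral_sum (cst 1) right_half = spectral_sum (cst 1) left_half }.
Implicit Type P : profile.

Definition sobolev P : W21 R :=
  profile_W21 _ _ (right_decaying P) (left_decaying P) (halves_agree P).
Definition transform P : R -> R[i] := fourier_tail (right_half P) (left_half P) 0.
Definition sobolev_energy P :=
  energy (right_half P) + energy (left_half P) +
  (energy (reweight id (right_half P)) + energy (reweight id (left_half P))).

Lemma decaying_exp : decaying [:: (1 : R, 1 : R)].
Proof. by move=> t; rewrite inE => /eqP ->. Qed.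

Definition exponential_profile : profile :=
  Profile _ _ decaying_exp decaying_exp erefl.

Section Step.
Variable P : profile.
Let p := right_half P.
Let q := left_half P.
Let a := cutoff p q.
Let a1 : 1 <= a := cutoff_ge1 p q (right_decaying P).
Let pa t (tp : t \in p) : t.2 < a := cutoff_gt p q t (right_decaying P) tp.

Fact allpass_right_decaying : decaying (allpass_right a p q).
Proof.
apply: decaying_reweight; apply: decaying_low_right => //; exact: right_decaying.
Qed.

Fact allpass_left_decaying : decaying (allpass_left a q).
Proof. by do 2 apply: decaying_reweight; exact: left_decaying. Qed.

Fact allpass_halves_agree :
  spectral_sum (cst 1) (allpass_left a q) = spectral_sum (cst 1) (allpass_right a p q).
Proof.
apply/esym/allpass_continuous => //; first exact: left_decaying.
exact: halves_agree.
Qed.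

(** Exchanging the two halves is the reflection of the line. *)
Definition allpass_reflect : profile :=
  Profile _ _ allpass_left_decaying allpass_right_decaying allpass_halves_agree.

Lemma sobolev_energy_step : sobolev_energy allpass_reflect = sobolev_energy P.
Proof.
have dp := right_decaying P; have dq := left_decaying P.
rewrite /sobolev_energy /= -/p -/q -(energy_allpass a p q)//.
rewrite -(energy_allpass_derivative a p q) //; last exact: halves_agree.
by rewrite [X in X + _]addrC [X in _ + X]addrC.
Qed.

(** The exchange of the halves changes the sign of the imaginary part. *)
Lemma cmod_transform_step k : cmod (transform allpass_reflect k) = cmod (transform P k).
Proof.
have dp := right_decaying P; have dq := left_decaying P.
rewrite /transform !fourier_tail0 /cmod /=; congr Num.sqrt.
rewrite -(fourier_allpass a p q k)//; congr (_ ^+ 2 + _).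
  by rewrite /fourier_re addrC.
by rewrite -sqrrN /fourier_im opprB.
Qed.

(** [spectral_sum id] of the left half is the left slope and that of the right
    half is minus the right slope.  Up to the error [e] the filter keeps the left
    slope and reflects the right slope through it, and the exchange of the halves
    changes the signs of the slopes. *)
Lemma slopes_step : exists2 e, `|e| <= 1 &
  spectral_sum id (right_half allpass_reflect) = spectral_sum id q - e /\
  spectral_sum id (left_half allpass_reflect) =
    e - 2 * spectral_sum id q - spectral_sum id p.
Proof.
have dp := right_decaying P; have dq := left_decaying P.
exists (slope_error a q); first exact: cutoff_error.
split; first exact: allpass_left_slope.
by apply: allpass_right_slope => //; exact: halves_agree.
Qed.

End Step.

Definition focusing (n : nat) : profile := iter n allpass_reflect exponential_profile.

Lemma focusing_energy n : sobolev_energy (focusing n) = sobolev_energy exponential_profile.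
Proof. by elim: n => // n <-; exact: sobolev_energy_step. Qed.

Lemma focusing_transform n k :
  cmod (transform (focusing n) k) = cmod (transform exponential_profile k).
Proof. by elim: n => // n <-; exact: cmod_transform_step. Qed.

(** The first equation says that the jump of the derivative has constant size and
    alternating sign; it makes the left slope increase by about [2], hence by at
    least [1], in absolute value at each step. *)
Lemma focusing_slopes n :
  spectral_sum id (right_half (focusing n)) + spectral_sum id (left_half (focusing n))
    = 2 * (-1) ^+ n /\
  n%:R + 1 <= (-1) ^+ n * spectral_sum id (left_half (focusing n)).
Proof.
elim: n => [|n [ih1 ih2]].
  by rewrite /= /spectral_sum !big_seq1 /= expr0; lra.
have [e he [e1 e2]] := slopes_step (focusing n).
rewrite /focusing iterS -/(focusing n) e1 e2 exprS mulN1r; split; first lra.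
have -> : - (-1) ^+ n * (e - 2 * spectral_sum id (left_half (focusing n)) -
    spectral_sum id (right_half (focusing n))) =
  (-1) ^+ n * (spectral_sum id (left_half (focusing n))) - (-1) ^+ n * e +
  (-1) ^+ n * (spectral_sum id (right_half (focusing n)) +
   spectral_sum id (left_half (focusing n))) by ring.
rewrite ih1 mulrCA -expr2 sqrr_sign mulr1.
have : (-1) ^+ n * e <= 1.
  by apply: le_trans (ler_norm _) _; rewrite normrM normr_sign mul1r.
by rewrite -natr1; lra.
Qed.

Lemma focusing_slope_gt n : n%:R < `|spectral_sum id (left_half (focusing n))|.
Proof.
have [_ h] := focusing_slopes n.
apply: (@lt_le_trans _ _ (n%:R + 1)); first by rewrite ltrDl.
apply: le_trans h _; apply: le_trans (ler_norm _) _.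
by rewrite normrM normr_sign mul1r.
Qed.

End Sequence.

Theorem theorem1 (R : realType) :
  exists (f : nat -> W21 R) (fhat : nat -> R -> R[i]),
    [/\ forall n : nat, is_fourier_transform (f n) (fhat n),
        forall n m : nat,
          {ae @lebesgue_measure R, forall k : R, cmod (fhat n k) = cmod (fhat m k)},
        forall n m : nat, w21_norm (f n) = w21_norm (f m) &
        [/\ (ereal_sup (range (fun n : nat => cLnorm +oo%E (f n))) < +oo)%E,
            forall n : nat, (cLnorm +oo%E (w21_deriv (f n)) < +oo)%E &
            cLnorm +oo%E (w21_deriv (f n)) @[n --> \oo] --> +oo%E]].
Proof.
exists (fun n => sobolev (focusing n)), (fun n => transform (focusing n)); split.
- by move=> n; apply: is_fourier_transform_two_sided;
    [exact: right_decaying|exact: left_decaying].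
- by move=> n m; apply: aeW => k; rewrite !focusing_transform.
- move=> n m; rewrite !w21_norm_profile -!/(sobolev_energy _).
  by rewrite !focusing_energy.
split.
- pose E := sobolev_energy (@exponential_profile R).
  apply: (@le_lt_trans _ _ (Num.sqrt E)%:E); last exact: ltry.
  apply: ge_ereal_sup => _ [n _ <-]; apply: cLnormy_le => x; rewrite cmod_real.
  rewrite -sqrtr_sqr ler_wsqrtr// /E -(focusing_energy n).
  by apply: two_sided_sqr_le; [exact: right_decaying|exact: left_decaying].
- move=> n.
  apply: le_lt_trans (cLnormy_le _ _ _) (ltry _) => x; rewrite cmod_real.
  by apply: two_sided_le; apply: decaying_reweight;
    [exact: right_decaying|exact: left_decaying].
- apply/cvgeyPge => M; near=> n.
  apply: (@le_trans _ _ (n%:R)%:E); last first.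
    by apply: cLnormy_profile_derivative; exact: focusing_slope_gt.
  by rewrite lee_fin; near: n; exact: nbhs_infty_ger.
Unshelve. all: by end_near. Qed.
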